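(* Let $T$ be a complete first-order theory with infinite models. Given $m>0$, if $T$ is $m$-distal, then it is also $m$-dependent.
   Context: Conventions. $T$ is a complete first-order theory in a language $L$ with infinite models, and $\mathcal{U}\models T$, with universe $U$, is a monster model: universal and strongly $\hat\kappa$-homogeneous for a sufficiently large cardinal $\hat\kappa$. ''Small'' means of cardinality $<\hat\kappa$. Variables and parameters may be tuples (finite or infinite, small); all sequences of parameters are small. EM-types. A sequence $\mathcal{I}=(b_i:i\in I)$ of tuples of the same size, indexed by an infinite linear order, satisfies $\mathcal I\models^{\mathrm{EM}}\phi(x_0,\dots,x_{n-1})$ if $\mathcal{U}\models\phi(b_{i_0},\dots,b_{i_{n-1}})$ for all $i_0<\cdots<i_{n-1}$ in $I$. The EM-type of $\mathcal I$ (over $\varnothing$) is the set of all $L$-formulas $\phi$ in variables $(x_k:k<\omega)$ with $\mathcal I\models^{\mathrm{EM}}\phi$; $\mathcal I$ is indiscernible iff this EM-type is complete. A complete EM-type is the EM-type of some infinite indiscernible sequence. Dedekind partitions. A partition $I=I_0+\cdots+I_n$ of a linear order into nonempty convex sets $I_0<\cdots<I_n$ is Dedekind if for each $i<n$ the set $I_0\cup\cdots\cup I_i$ has no maximum and $I_{i+1}\cup\cdots\cup I_n$ has no minimum; the $i$-th cut is $\mathfrak c_i=(I_0\cup\cdots\cup I_i,\ I_{i+1}\cup\cdots\cup I_n)$. For an indiscernible sequence $\mathcal I$ indexed by $I$, write $\mathcal I=\mathcal I_0+\cdots+\mathcal I_n$ for the corresponding partition. Given $A=(a_0,\dots,a_{n-1})$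 of tuples of the same size as those in $\mathcal I$, a subsequence $A'\subseteq A$ inserts into $\mathcal I_0+\cdots+\mathcal I_n$ if the sequence obtained by inserting each $a_i\in A'$ at the cut $\mathfrak c_i$ is indiscernible. $m$-distality. For $n>m>0$, the Dedekind partition $\mathcal I_0+\cdots+\mathcal I_n$ of an indiscernible sequence is $m$-distal if every sequence $A=(a_0,\dots,a_{n-1})$ which does not insert contains an $m$-element subsequence which does not insert. A complete EM-type $\Gamma$ is $m$-distal if every Dedekind partition $\mathcal I_0+\cdots+\mathcal I_{m+1}$ of an indiscernible sequence with EM-type $\Gamma$ is $m$-distal. $T$ is $m$-distal if every complete EM-type, in every tuple size, is $m$-distal. $m$-dependence. For $m>0$, a formula $\phi(x_0,\dots,x_{m-1},y)$ with parameters from $U$ is $m$-independent ($\mathrm{IP}_m$) if there are infinite sets $A_i\subseteq U^{|x_i|}$, $i<m$, such that for every subset $B\subseteq A_0\times\cdots\times A_{m-1}$ there is $b\in U^{|y|}$ such that $B$ is exactly the set of $(a_0,\dots,a_{m-1})\in A_0\times\cdots\times A_{m-1}$ with $\mathcal{U}\models\phi(a_0,\dots,a_{m-1},b)$. $T$ is $m$-dependent ($\mathrm{NIP}_m$) if no formula $\phi(x_0,\dots,x_{m-1},y)$ with parameters from $U$ is $\mathrm{IP}_m$. *)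

(* Defs.v *)
From mathcomp Require Import all_boot all_order all_classical.

Set Implicit Arguments.
Unset Strict Implicit.
Unset Printing Implicit Defensive.

Local Open Scope classical_set_scope.
Local Open Scope card_scope.

(** * First-order logic *)

Record language : Type := Language {
  fsym : Type;
  farity : fsym -> nat;
  rsym : Type;
  rarity : rsym -> nat }.

Inductive term (L : language) (V : Type) : Type :=
| Var of V
| App (f : fsym L) of ('I_(farity f) -> term L V).

(* [formula L V] is the type of L-formulas whose free variables are among V.
   Formulas are well scoped: in [All phi] the variable [None] of
   [phi : formula L (option V)] is the one bound by the quantifier. *)
Inductive formula (L : language) (V : Type) : Type :=
| Falsum
| Eq of term L V & term L V
| Rel (r : rsym L) of ('I_(rarity r) -> term L V)
| Imp of formula L V & formula L V
| All of formula L (option V).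

Arguments Falsum {L V}.

Definition Not (L : language) (V : Type) (phi : formula L V) : formula L V :=
  Imp phi Falsum.

Record structure (L : language) : Type := Structure {
  dom :> Type;
  dom_inhabited : inhabited dom;
  fint : forall f : fsym L, ('I_(farity f) -> dom) -> dom;
  rint : forall r : rsym L, ('I_(rarity r) -> dom) -> Prop }.

Section Semantics.
Context (L : language).

Fixpoint eval (M : structure L) (V : Type) (v : V -> M) (t : term L V) : M :=
  match t with
  | Var x => v x
  | App f ts => fint (fun k => eval v (ts k))
  end.

Fixpoint sat (M : structure L) (V : Type) (v : V -> M) (phi : formula L V)
    {struct phi} : Prop :=
  match phi with
  | Falsum => False
  | Eq t u => eval v t = eval v u
  | Rel r ts => rint (fun k => eval v (ts k))
  | Imp phi psi => sat v phi -> sat v psi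
  | All phi => forall c : M, sat (fun x => oapp v c x) phi
  end.

Definition theory : Type := set (formula L void).

Definition holds (M : structure L) (phi : formula L void) : Prop :=
  sat (of_void M) phi.

Definition models (M : structure L) (T : theory) : Prop :=
  forall phi, T phi -> holds M phi.

Definition entails (T : theory) (phi : formula L void) : Prop :=
  forall M : structure L, models M T -> holds M phi.

Definition complete_theory (T : theory) : Prop :=
  (exists M : structure L, models M T) /\
  (forall phi, entails T phi \/ entails T (Not phi)).

Definition has_infinite_models (T : theory) : Prop :=
  exists M : structure L, models M T /\ infinite_set [set: M].

Definition elementary_embedding (M N : structure L) (h : M -> N) : Prop :=
  forall (V : Type) (phi : formula L V) (v : V -> M),
    sat v phi <-> sat (h \o v) phi.

Definition automorphism (M : structure L) (s : M -> M) : Prop :=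
  [/\ bijective s,
      (forall (f : fsym L) (c : 'I_(farity f) -> M),
         s (fint c) = fint (s \o c)) &
      (forall (r : rsym L) (c : 'I_(rarity r) -> M),
         rint c <-> rint (s \o c))].

End Semantics.

(** * Monster models *)

(* A cardinal is represented by a type K of that cardinality. *)
Definition small (K X : Type) : Prop :=
  ([set: X] #<= [set: K]) /\ ~ ([set: K] #<= [set: X]).

(* The cardinality of [formula L nat] is |L| + aleph_0, so this says that
   the cardinal K is uncountable and exceeds |L|. *)
Definition sufficiently_large (L : language) (K : Type) : Prop :=
  small K (formula L nat).

Section Monster.
Context (L : language) (K : Type) (U : structure L).

Definition universal (T : theory L) : Prop :=
  forall M : structure L, small K M -> models M T ->
    exists h : M -> U, elementary_embedding h.

Definition same_type (X : Type) (a b : X -> U) : Prop :=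
  forall phi : formula L X, sat a phi <-> sat b phi.

(* [same_type a b] says that a x |-> b x is a (well-defined) partial
   elementary map. *)
Definition strongly_homogeneous : Prop :=
  forall (X : Type) (a b : X -> U), small K X -> same_type a b ->
    exists2 s : U -> U, automorphism s & forall x, s (a x) = b x.

Definition monster (T : theory L) : Prop :=
  [/\ models U T, universal T & strongly_homogeneous].

(** * EM-types *)

(* A tuple of size X is a function X -> U, and an EM-type for tuples of size X
   is a set of formulas phi(x_0, ..., x_{n-1}), n < omega, where (k, x) is the
   x-th coordinate of the tuple of variables x_k. *)
Definition em_formulas (X : Type) : Type :=
  forall n, set (formula L ('I_n * X)).

(* Index orders are given by a strict order [lt], so that this also applies to
   the sequences obtained by insertion below. *)
Definition em_sat (I X : Type) (lt : rel I) (b : I -> X -> U) (n : nat)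
    (phi : formula L ('I_n * X)) : Prop :=
  forall t : 'I_n -> I, (forall k l : 'I_n, (k < l)%N -> lt (t k) (t l)) ->
    sat (fun z => b (t z.1) z.2) phi.

Definition em_type (I X : Type) (lt : rel I) (b : I -> X -> U) :
  em_formulas X := fun n => [set phi | em_sat lt b phi].

Definition em_complete (X : Type) (G : em_formulas X) : Prop :=
  forall n (phi : formula L ('I_n * X)), G n phi \/ G n (Not phi).

Definition indiscernible (I X : Type) (lt : rel I) (b : I -> X -> U) : Prop :=
  em_complete (em_type lt b).

Definition complete_em_type (X : Type) (G : em_formulas X) : Prop :=
  exists (d : Order.disp_t) (I : orderType d) (b : I -> X -> U),
    [/\ small K I, infinite_set [set: I], indiscernible <%O b &
        em_type <%O b = G].

(** * Dedekind partitions and insertion *)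

(* A partition I_0 + ... + I_n of I into nonempty convex sets
   I_0 < ... < I_n is given by the monotone surjection p : I -> {0, ..., n}
   with fibres I_k. *)
Definition dedekind_partition (d : Order.disp_t) (I : orderType d) (n : nat)
    (p : I -> 'I_n.+1) : Prop :=
  [/\ (forall k, exists i, p i = k),
      (forall i j, (i <= j)%O -> (p i <= p j)%N) &
      (forall k : 'I_n,
        (~ exists2 i, (p i <= k)%N & forall j, (p j <= k)%N -> (j <= i)%O) /\
        (~ exists2 i, (k < p i)%N & forall j, (k < p j)%N -> (i <= j)%O))].

(* The order on I extended by one point at each cut c_k, k \in J. *)
Definition insertion_lt (d : Order.disp_t) (I : orderType d) (n : nat)
    (p : I -> 'I_n.+1) (J : {set 'I_n}) : rel (I + {k : 'I_n | k \in J}) :=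
  fun u w =>
    match u, w with
    | inl i, inl j => (i < j)%O
    | inl i, inr k => (p i <= val k)%N
    | inr k, inl j => (val k < p j)%N
    | inr k, inr l => (val k < val l)%N
    end.

Definition insertion_seq (I X : Type) (n : nat) (b : I -> X -> U)
    (a : 'I_n -> X -> U) (J : {set 'I_n}) :
    I + {k : 'I_n | k \in J} -> X -> U :=
  fun u => match u with inl i => b i | inr k => a (val k) end.
Arguments insertion_seq {I X n} b a J.

(* The subsequence of (a_0, ..., a_{n-1}) with index set J inserts. *)
Definition inserts (d : Order.disp_t) (I : orderType d) (X : Type) (n : nat)
    (p : I -> 'I_n.+1) (b : I -> X -> U) (a : 'I_n -> X -> U)
    (J : {set 'I_n}) : Prop :=
  indiscernible (insertion_lt p (J := J)) (insertion_seq b a J).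

(** * m-distality and m-dependence *)

Definition m_distal_partition (m : nat) (d : Order.disp_t) (I : orderType d)
    (X : Type) (n : nat) (p : I -> 'I_n.+1) (b : I -> X -> U) : Prop :=
  forall a : 'I_n -> X -> U, ~ inserts p b a [set: 'I_n]%SET ->
    exists2 J : {set 'I_n}, #|J| = m & ~ inserts p b a J.

Definition m_distal_em_type (m : nat) (X : Type) (G : em_formulas X) : Prop :=
  forall (d : Order.disp_t) (I : orderType d) (b : I -> X -> U)
      (p : I -> 'I_(m.+1).+1),
    small K I -> infinite_set [set: I] ->
    indiscernible <%O b -> em_type <%O b = G ->
    dedekind_partition p -> m_distal_partition m p b.

Definition m_distal (m : nat) : Prop :=
  forall (X : Type) (G : em_formulas X), small K X -> complete_em_type G ->
    m_distal_em_type m G.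

(* The variables of a formula phi(x_0, ..., x_{m-1}, y) with parameters from U:
   coordinates of the x_i, coordinates of y, and elements of U. *)
Definition ip_env (m : nat) (X : 'I_m -> Type) (Y : Type)
    (a : forall i, X i -> U) (c : Y -> U) (z : {i : 'I_m & X i} + Y + U) : U :=
  match z with
  | inl (inl (existT i x)) => a i x
  | inl (inr y) => c y
  | inr u => u
  end.

Definition m_independent_formula (m : nat) (X : 'I_m -> Type) (Y : Type)
    (phi : formula L ({i : 'I_m & X i} + Y + U)) : Prop :=
  exists A : forall i, set (X i -> U),
    (forall i, infinite_set (A i)) /\
    forall B : set (forall i, X i -> U),
      B `<=` [set a | forall i, A i (a i)] ->
      exists c : Y -> U,
        B = [set a | (forall i, A i (a i)) /\ sat (ip_env a c) phi].

Definition m_dependent (m : nat) : Prop :=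
  forall (X : 'I_m -> Type) (Y : Type)
      (phi : formula L ({i : 'I_m & X i} + Y + U)),
    (forall i, small K (X i)) -> small K Y -> ~ m_independent_formula phi.

End Monster.

(* Main.v *)
Require Import Defs.
From mathcomp Require Import all_boot all_order all_classical.
From mathcomp Require Import ssralg ssrnum ssrint.

(** If phi(x_0, ..., x_(m-1), y) has IP_m, then every finite (m+1)-partite
    hypergraph is realized by phi on suitable tuples.  We want a sequence with
    points a_0, ..., a_m at distinct cuts that becomes indiscernible when any
    a_j is removed, while phi on a_0, ..., a_m disagrees with phi on the rest of
    the sequence; this contradicts m-distality.  By compactness it suffices to
    find arbitrarily large finite approximations, for finitely many formulas.
    Place N tuples in each of many blocks.  Ramsey's theorem and averaging give
    a finite background for which a positive proportion, independent of N, of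
    the choices (a_0, ..., a_m) is homogeneous over it.  The set H of choices
    that are homogeneous whenever one a_j is dropped is determined by m + 1
    relations of arity m, so there are only 2 ^ O(N ^ m) possibilities for it,
    and a counting argument yields a hypergraph that is constant on no such
    dense H.  Then phi takes both truth values on H.

    The compactness theorem has to produce a small model, so that universality
    applies: it is the Skolem hull inside an ultrapower of the monster. *)

Set Implicit Arguments.
Unset Strict Implicit.
Unset Printing Implicit Defensive.

Import Order.TTheory GRing.Theory Num.Theory.

(** * Combinatorics *)

(** By induction on [n]: pass to a subsequence on which the colour of a tuple depends only on its
    first entry, then keep the entries of the majority colour. *)
Lemma ramsey n q :
  exists M, forall (T : eqType) (chi : seq T -> bool) (u : seq T),
    M <= size u -> exists w, [/\ subseq w u, size w = q &
      exists b, forall z, subseq z w -> size z = n -> chi z = b].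
Proof.
elim: n q => [|n IHn] q.
  exists q => T chi u qu; exists (take q u); split; first exact: take_subseq.
    by rewrite size_takel.
  by exists (chi [::]) => z _ /size0nil ->.
have endhom k : exists M, forall (T : eqType) (chi : seq T -> bool) (u : seq T),
    M <= size u -> exists w, [/\ subseq w u, size w = k &
      exists h : T -> bool, forall x z,
        subseq (x :: z) w -> size z = n -> chi (x :: z) = h x].
  elim: k => [|k [M IHk]].
    exists 0 => T chi u _; exists [::]; split; rewrite ?sub0seq //.
    by exists xpredT.
  have [M' HM'] := IHn M; exists M'.+1 => T chi [//|y u]; rewrite ltnS => su.
  have [u' [u'u su' [b hb]]] := HM' T (fun z => chi (y :: z)) u su.
  have [|w [wu' sw [h hh]]] := IHk T chi u'; first by rewrite su'.
  exists (y :: w); split; first by rewrite /= eqxx (subseq_trans wu').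
    by rewrite /= sw.
  (* Repeated entries are harmless: if [x] equals [y], [subseq] matches it with the head, so [z]
     lies in [w]. *)
  exists (fun x => if x == y then b else h x) => x z /=.
  case: eqP => [->|_] zw sz; last exact: hh.
  by apply: hb => //; apply: subseq_trans wu'.
have [M HM] := endhom (q + q); exists M => T chi u su.
have [w [wu sw [h hh]]] := HM T chi u su.
have [b qb] : exists b, q <= size (seq.filter (fun x => h x == b) w).
  have := count_predC (fun x => h x == true) w.
  rewrite sw => /eqP; have [qt _|tq /eqP e] := leqP q (count (fun x => h x == true) w).
    by exists true; rewrite size_filter.
  exists false; rewrite size_filter.
  rewrite -(leq_add2l (count (fun x => h x == true) w)).
  have -> : count (fun x => h x == false) w = count (predC (fun x => h x == true)) w.
    by apply: eq_count => x /=; case: (h x).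
  by rewrite e leq_add2r ltnW.
exists (take q (seq.filter (fun x => h x == b) w)); split.
- by rewrite (subseq_trans (take_subseq _ _)) // (subseq_trans (filter_subseq _ _)).
- by rewrite size_takel.
- exists b => -[//|x z] zw [sz].
  have zf := subseq_trans zw (take_subseq _ _).
  rewrite (hh _ _ (subseq_trans zf (filter_subseq _ _)) sz).
  have : x \in seq.filter (fun x => h x == b) w.
    by apply: (mem_subseq zf); rewrite inE eqxx.
  by rewrite mem_filter => /andP[/eqP].
Qed.

Lemma ramsey_family (ns : seq nat) q :
  exists M, forall (T : eqType) (chi : nat -> seq T -> bool) (u : seq T),
    M <= size u -> exists w, [/\ subseq w u, size w = q &
      forall l, l < size ns -> exists b, forall z,
        subseq z w -> size z = nth 0 ns l -> chi l z = b].
Proof.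
elim: ns q => [|n ns IH] q.
  exists q => T chi u qu; exists (take q u); split => //; first exact: take_subseq.
  by rewrite size_takel.
have [M1 H1] := ramsey n q; have [M2 H2] := IH M1; exists M2 => T chi u su.
have [w2 [w2u sw2 hw2]] := H2 T (fun l => chi l.+1) u su.
have [|w [ww2 sw hw]] := H1 T (chi 0) w2; first by rewrite sw2.
exists w; split => //; first exact: subseq_trans w2u.
move=> [_|l]; first exact: hw.
rewrite ltnS => /hw2[b hb]; exists b => z zw sz.
by apply: hb => //; apply: subseq_trans ww2.
Qed.

Lemma subseq_map_nth (T : eqType) (x0 : T) (w : seq T) (s : seq nat) :
  sorted ltn s -> all (fun i => i < size w) s ->
  subseq [seq nth x0 w i | i <- s] w.
Proof.
move=> ss /allP sw; rewrite -[X in subseq _ X](mkseq_nth x0) /mkseq.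
apply: map_subseq.
suff -> : s = seq.filter (mem s) (iota 0 (size w)) by apply: filter_subseq.
apply: (irr_sorted_eq ltn_trans ltnn) => //.
  by apply: sorted_filter; [apply: ltn_trans | apply: iota_ltn_sorted].
move=> i; rewrite mem_filter mem_iota /= andb_idr //; exact: sw.
Qed.

(** An increasing tuple is coded as a subsequence of [enum 'I_M.+1]; on such codes the default
    values in [chi'] do not matter. *)
Lemma ramsey_ord r q (n : 'I_r -> nat) :
  exists M, forall chi : forall l, ('I_(n l) -> 'I_M.+1) -> bool,
    exists2 W : 'I_q -> 'I_M.+1, {homo W : i j / (i < j)%O} &
      forall l (t t' : 'I_(n l) -> 'I_q),
        {homo t : i j / (i < j)%O} -> {homo t' : i j / (i < j)%O} ->
        chi l (W \o t) = chi l (W \o t').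
Proof.
have [M HM] := ramsey_family [seq n l | l <- enum 'I_r] q; exists M => chi.
pose chi' (l : nat) (z : seq 'I_M.+1) : bool :=
  if insub l is Some l then chi l (fun k => nth ord0 z k) else true.
have [|w [wu sw hw]] := HM _ chi' (enum 'I_M.+1).
  by rewrite size_enum_ord.
have ws : sorted (fun i j : 'I_M.+1 => i < j) w.
  apply: (subseq_sorted _ wu); first by move=> ? ? ?; apply: ltn_trans.
  by have := iota_ltn_sorted 0 M.+1; rewrite -val_enum_ord sorted_map.
exists (fun i => nth ord0 w i) => [i j ij|l t t' it it'].
  apply: (sorted_ltn_nth (leT := fun i j : 'I_M.+1 => i < j)) => //.
  - by move=> ? ? ?; apply: ltn_trans.
  - by rewrite inE sw.
  - by rewrite inE sw.
have [|b hb] := hw l; first by rewrite size_map size_enum_ord.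
have key (t1 : 'I_(n l) -> 'I_q) : {homo t1 : i j / (i < j)%O} ->
    chi l ((fun i : 'I_q => nth ord0 w i) \o t1) = b.
  move=> it1.
  rewrite -(hb [seq nth ord0 w i | i <- [seq val (t1 k) | k <- enum 'I_(n l)]]).
  - rewrite /chi' valK; congr (chi l _); apply: funext => k /=.
    rewrite (nth_map 0); last by rewrite size_map size_enum_ord.
    by rewrite (nth_map k) ?size_enum_ord ?nth_ord_enum.
  - apply: subseq_map_nth.
      rewrite sorted_map.
      have := iota_ltn_sorted 0 (n l); rewrite -val_enum_ord sorted_map.
      by apply: sub_sorted => i j; apply: it1.
    by apply/allP => _ /mapP[k _ ->]; rewrite sw; apply: ltn_ord.
  - rewrite size_map size_map size_enum_ord (nth_map l) ?size_enum_ord //.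
    by rewrite nth_ord_enum.
by rewrite !key.
Qed.

(** * Averaging and the counting of cylinder intersections *)

Lemma pigeonhole (A B : finType) (h : A -> B) (D : {set A}) c :
  0 < #|D| -> #|h @: D| <= c ->
  exists b, #|D| <= c * #|[set a in D | h a == b]|.
Proof.
move=> /card_gt0P[a0 _] Dc.
pose F b := #|[set a in D | h a == b]|.
(* A largest fibre has at least the average size. *)
pose b := [arg max_(i > h a0) F i].
exists b; rewrite -[X in X <= _]sum1_card (partition_big_imset h) /=.
apply: (@leq_trans (\sum_(i in h @: D) F b)).
  apply: leq_sum => i _.
  have -> : \sum_(j in D | h j == i) 1 = F i.
    by rewrite /F -sum1_card; apply: eq_bigl => a; rewrite inE.
  by rewrite /b; case: arg_maxnP => // k _; apply.
by rewrite sum_nat_const leq_mul2r Dc orbT.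
Qed.

Lemma card_set_type (T : finType) : #|{: {set T}}| = 2 ^ #|T|.
Proof. by rewrite -(cardsT {set T}) -finset.powersetT card_powerset cardsT. Qed.

(** The cylinder intersections of communication complexity: the [j]-th condition does not see the
    coordinate [f j]. *)
Definition cylinder_intersection m (A : finType)
    (S : 'I_m.+1 -> {set {ffun 'I_m -> A}}) : {set {ffun 'I_m.+1 -> A}} :=
  [set f : {ffun 'I_m.+1 -> A} | [forall j, [ffun k => f (lift j k)] \in S j]].

(* Counting: there are only 2 ^ O(N ^ m) cylinder intersections, and each one
   of density at least 1 / P is constant for at most 2 ^ (N ^ m.+1 * (1 - 1 / P))
   of the 2 ^ (N ^ m.+1) hypergraphs. *)
Lemma generic_hypergraph m P :
  exists N, exists g : {ffun 'I_m.+1 -> 'I_N.+1} -> bool,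
  forall S : {ffun 'I_m.+1 -> {set {ffun 'I_m -> 'I_N.+1}}},
    N.+1 ^ m.+1 <= P * #|cylinder_intersection S| ->
    forall v, exists2 f, f \in cylinder_intersection S & g f = v.
Proof.
(* This gives [P * m.+2 < N.+1], and also [m.+2 < N.+1] when [P] is 0. *)
pose N := P.+1 * m.+2; exists N.
apply: contrapT => Hno.
pose F := {ffun 'I_m.+1 -> 'I_N.+1}.
pose C := {ffun 'I_m.+1 -> {set {ffun 'I_m -> 'I_N.+1}}}.
pose H (S : C) := cylinder_intersection S.
(* There are [2 ^ X] pairs of a family [S] and a truth value; [h] is chosen so that [2 ^ X * 2 ^ h]
   stays below [2 ^ K]. *)
pose K := N.+1 ^ m.+1; pose X := (N.+1 ^ m * m.+1).+1; pose h := K - X.+1.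
have XN : X <= N.+1 ^ m * m.+2.
  by rewrite /X [in leqRHS]mulnSr -addn1 leq_add2l expn_gt0.
have cF : #|{: F}| = K by rewrite card_ffun !card_ord.
pose good (x : C * bool) := K <= P * #|H x.1|.
pose bad (x : C * bool) :=
  [set E : {set F} | E :&: H x.1 == if x.2 then H x.1 else finset.set0].
(* If no hypergraph is as desired, each one is constant on some dense cylinder intersection. *)
have cover : [set: {set F}] \subset \bigcup_(x | good x) bad x.
  apply/fintype.subsetP => E _; apply/bigcupP; apply: contrapT => nE; apply: Hno.
  exists (fun f => f \in E) => S Hbig v; apply: contrapT => nv.
  apply: nE; exists (S, ~~ v); first exact: Hbig.
  rewrite inE; apply/eqP/setP => f; rewrite inE /=.
  case fH: (f \in H S); last first.
    by rewrite andbF; case: (~~ v); rewrite ?fH ?finset.in_set0.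
  rewrite andbT; case: v nv => /= nv; rewrite ?fH ?finset.in_set0.
    by apply/negP => fE; apply: nv; exists f.
  by apply: contrapT => /negP fE; apply: nv; exists f => //; apply/negbTE.
have badle x : good x -> #|bad x| <= 2 ^ (K - #|H x.1|).
  move=> _; rewrite -cF -(cardsC (H x.1)) addKn -card_powerset.
  have inj : {in bad x &, injective (fun E => E :\: H x.1)}.
    move=> E1 E2; rewrite !inE => /eqP e1 /eqP e2 e.
    by rewrite -(finset.setID E1 (H x.1)) -(finset.setID E2 (H x.1)) e1 e2 e.
  rewrite -(card_in_imset inj); apply: subset_leq_card.
  apply/fintype.subsetP => _ /imsetP[E _ ->].
  by rewrite inE finset.subsetDr.
have := subset_leq_card cover.
rewrite cardsT card_set_type cF leqNgt; case/negP.
apply: (@leq_ltn_trans (\sum_(x | good x) #|bad x|)).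
  elim/big_rec2: _ => [|x a s _ IH]; first by rewrite cards0.
  by rewrite (leq_trans (leq_card_setU _ _)) // leq_add2l.
apply: (@leq_ltn_trans (\sum_(x : C * bool) 2 ^ h)).
  rewrite [X in X <= _]big_mkcond /=; apply: leq_sum => x _.
  case: ifP => // gx; apply: leq_trans (badle x gx) _.
  (* A good cylinder intersection has more than [X] elements, because [P * X < K]. *)
  rewrite leq_exp2l //; apply: leq_sub2l; rewrite ltnNge; apply/negP => small.
  have := leq_trans gx (leq_mul (leqnn P) small).
  rewrite /K expnSr leqNgt => /negP; apply.
  apply: (@leq_ltn_trans (P * (N.+1 ^ m * m.+2))); first by rewrite leq_mul2l XN orbT.
  rewrite mulnCA.
  by rewrite ltn_pmul2l ?expn_gt0 // ltnS /N leq_mul2r leqnSn orbT.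
rewrite sum_nat_const card_prod card_bool card_ffun card_ord card_set_type.
rewrite card_ffun !card_ord.
rewrite -expnM -expnSr -expnD ltn_exp2l // -/X.
have XK : X < K.
  rewrite /K expnSr; apply: leq_ltn_trans XN _.
  by rewrite ltn_pmul2l ?expn_gt0 // ltnS /N leq_pmull.
by rewrite /h -[X in _ < X](subnKC XK) ltn_add2r.
Qed.

(* Vertices are pairs (block, label), and [g] prescribes a hypergraph on labels.
   Each label assignment [s] has a Ramsey-homogeneous set [W] of blocks; by
   averaging, for some [W] and some labels outside [alpha] this happens for a
   positive proportion of the labels [f] at [alpha].  Being homogeneous away
   from [alpha j] depends only on [f] off [j], so the good [f] contain a dense
   cylinder intersection, on which [g] takes both values. *)
Lemma transversal_ramsey m r q (n : 'I_r -> nat) (alpha : 'I_m.+1 -> 'I_q) :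
  injective alpha ->
  exists M N, exists g : {ffun 'I_m.+1 -> 'I_N.+1} -> bool,
  forall chi : forall l, ('I_(n l) -> 'I_M.+1 * 'I_N.+1) -> bool,
  exists (W : 'I_q -> 'I_M.+1) (s : 'I_M.+1 -> 'I_N.+1),
    {homo W : i j / (i < j)%O} /\
    forall v, exists f (s' : 'I_M.+1 -> 'I_N.+1),
    [/\ g f = v,
        forall j, s' (W (alpha j)) = f j,
        forall u, (forall j, u != alpha j) -> s' (W u) = s (W u) &
        forall j l (t t' : 'I_(n l) -> 'I_q),
          {homo t : i j / (i < j)%O} -> {homo t' : i j / (i < j)%O} ->
          (forall k, t k != alpha j) -> (forall k, t' k != alpha j) ->
          chi l (fun k => (W (t k), s' (W (t k)))) =
          chi l (fun k => (W (t' k), s' (W (t' k))))].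
Proof.
move=> alpha_inj.
have [M HM] := ramsey_ord q n; exists M.
have [N [g Hg]] := generic_hypergraph m (M.+1 ^ q); exists N, g => chi.
have /choice[Ws HWs] : forall s : {ffun 'I_M.+1 -> 'I_N.+1},
    exists W : {ffun 'I_q -> 'I_M.+1}, {homo W : i j / (i < j)%O} /\
    forall l (t t' : 'I_(n l) -> 'I_q),
        {homo t : i j / (i < j)%O} -> {homo t' : i j / (i < j)%O} ->
        chi l (fun k => (W (t k), s (W (t k)))) =
        chi l (fun k => (W (t' k), s (W (t' k)))).
  move=> s; have [W hW hc] := HM (fun l t => chi l (fun k => (t k, s (t k)))).
  exists (finfun W); split => [i j ij|l t t' ht ht']; first by rewrite !ffunE hW.
  have := hc l t t' ht ht'; congr (chi l _ = chi l _); apply: funext => k /=;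
    by rewrite ffunE.
pose cW := M.+1 ^ q.
(* First averaging: one [W] serves at least a fraction [1 / cW] of all label assignments. *)
have [||W] := @pigeonhole _ _ Ws [set: {ffun 'I_M.+1 -> 'I_N.+1}] cW.
- by rewrite cardsT card_ffun !card_ord expn_gt0.
- by apply: leq_trans (max_card _) _; rewrite card_ffun !card_ord.
set D := [set a in _ | _]; rewrite cardsT card_ffun !card_ord => leD.
have [D0|Dpos] := posnP #|D|; first by move: leD; rewrite D0 muln0 leqn0 expn_eq0.
have [s1 s1D] : exists s, s \in D by apply/card_gt0P.
have WE s : s \in D -> Ws s = W by rewrite inE => /andP[_ /eqP].
have homoW : {homo W : i j / (i < j)%O} by rewrite -(WE _ s1D); case: (HWs s1).
have W_inj : injective W.
  move=> i j e; have [ij|ij|//] := ltgtP i j; have := homoW _ _ ij;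
    by rewrite e ltxx.
pose Q := [set W (alpha j) | j : 'I_m.+1].
have cQ : #|Q| = m.+1.
  by rewrite card_imset ?card_ord //; apply: inj_comp.
(* [r0] erases the labels on [Q]; the second averaging fixes the other labels to be those of
   [rho]. *)
pose r0 (s : {ffun 'I_M.+1 -> 'I_N.+1}) :=
  [ffun i => if i \in Q then ord0 else s i] : {ffun 'I_M.+1 -> 'I_N.+1}.
have cR : #|r0 @: D| <= N.+1 ^ (M.+1 - m.+1).
  have <- : #|~: Q| = M.+1 - m.+1.
    have := cardsC Q; rewrite cQ card_ord => e.
    by rewrite -[RHS](congr1 (subn^~ m.+1) e) addKn.
  have -> : N.+1 ^ #|~: Q| = #|pffun_on ord0 (mem (~: Q)) 'I_N.+1|.
    by rewrite card_pffun_on card_ord.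
  apply: subset_leq_card.
  apply/fintype.subsetP => _ /imsetP[s _ ->]; apply/pffun_onP; split=> //.
  by apply/fintype.subsetP => i; rewrite !inE ffunE; case: ifP; rewrite ?eqxx.
have [rho] := pigeonhole Dpos cR.
set D' := [set a in _ | _] => leD'.
pose res (s : {ffun 'I_M.+1 -> 'I_N.+1}) :=
  [ffun j => s (W (alpha j))] : {ffun 'I_m.+1 -> 'I_N.+1}.
have cres : #|res @: D'| = #|D'|.
  apply: card_in_imset => a b; rewrite !inE => /andP[_ /eqP ea] /andP[_ /eqP eb] e.
  apply/ffunP => i; have [/imsetP[j _ ->]|niQ] := boolP (i \in Q).
    by move/ffunP/(_ j): e; rewrite !ffunE.
  have /ffunP/(_ i) : r0 a = r0 b by rewrite ea eb.
  by rewrite !ffunE (negbTE niQ).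
(* The projections of [res @: D'] define the least cylinder intersection that contains it. *)
pose S := [ffun j => [set [ffun k => (f : {ffun 'I_m.+1 -> 'I_N.+1}) (lift j k)]
                          | f in res @: D']] :
   {ffun 'I_m.+1 -> {set {ffun 'I_m -> 'I_N.+1}}}.
pose H := cylinder_intersection S.
have subH : res @: D' \subset H.
  apply/fintype.subsetP => f fD; rewrite inE; apply/forallP => j; rewrite ffunE.
  by apply/imsetP; exists f.
have bigH : N.+1 ^ m.+1 <= cW * #|H|.
  have mM : m.+1 <= M.+1 by have := max_card (mem Q); rewrite cQ card_ord.
  rewrite -(@leq_pmul2l (N.+1 ^ (M.+1 - m.+1))) ?expn_gt0 // -expnD subnK //.
  apply: leq_trans leD _; rewrite mulnCA leq_mul2l; apply/orP; right.
  apply: leq_trans leD' _; rewrite leq_mul2l -cres subset_leq_card ?orbT //.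
exists W, rho; split => // v.
have [f fH gf] := Hg S bigH v.
exists f, (fun i => if [pick j | W (alpha j) == i] is Some j then f j else rho i).
have s'a j : (if [pick k | W (alpha k) == W (alpha j)] is Some k then f k
              else rho (W (alpha j))) = f j.
  case: pickP => [k /eqP/W_inj/alpha_inj->//|/(_ j)]; by rewrite eqxx.
have s'n u : (forall j, u != alpha j) -> 
   (if [pick k | W (alpha k) == W u] is Some k then f k else rho (W u)) = rho (W u).
  move=> nu; case: pickP => // k /eqP/W_inj e; by have := nu k; rewrite e eqxx.
split => // j l t t' ht ht' nt nt'.
(* [f] itself may lie outside [res @: D'], but off [j] it agrees with some [s] in [D'], for which
   [W] is homogeneous. *)
have := fH; rewrite inE => /forallP/(_ j).
rewrite ffunE => /imsetP[f' /imsetP[s sD' ->]] ef.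
have := sD'; rewrite inE => /andP[sD /eqP es].
have agree u : u != alpha j ->
  (if [pick k | W (alpha k) == W u] is Some k then f k else rho (W u)) = s (W u).
  move=> uj; have [/existsP[k /eqP uk]|nu] := boolP [exists k, u == alpha k].
    rewrite uk s'a; have jk : j != k by apply: contraNneq uj => ->; rewrite uk.
    have [k' ->] := unlift_some jk.
    by move/ffunP/(_ k'): ef; rewrite !ffunE.
  have nu' k : u != alpha k.
    by apply: contraNneq nu => e; apply/existsP; exists k; apply/eqP.
  rewrite s'n // -es ffunE; case: ifP => // /imsetP[k _ /W_inj e].
  by have := nu' k; rewrite e eqxx.
have [_ hc] := HWs s; rewrite (WE _ sD) in hc.
have := hc l t t' ht ht'.
by congr (chi l _ = chi l _); apply: funext => k; rewrite agree.
Qed.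

Local Open Scope classical_set_scope.
Local Open Scope card_scope.

(** * Compactness in a monster model *)

Lemma injective_card_le (A B : Type) (f : A -> B) :
  injective f -> [set: A] #<= [set: B].
Proof.
move=> f_inj; have f_inj' : {in [set: A] &, injective f} by move=> x y _ _ /f_inj.
by rewrite -(card_le_eql (inj_card_eq f_inj')); apply: card_leT.
Qed.

(** * Renaming of variables and finite support of formulas *)

Section Syntax.
Context (L : language).

Fixpoint rename_term V W (f : V -> W) (t : term L V) : term L W :=
  match t with
  | Var x => Var L (f x)
  | App g ts => App (fun k => rename_term f (ts k))
  end.

Fixpoint rename V W (f : V -> W) (phi : formula L V) {struct phi} : formula L W :=
  match phi with
  | Falsum => Falsum
  | Eq t u => Eq (rename_term f t) (rename_term f u)
  | Rel r ts => Rel (fun k => rename_term f (ts k))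
  | Imp phi psi => Imp (rename f phi) (rename f psi)
  | All phi => All (rename (omap f) phi)
  end.

Lemma eval_rename (M : structure L) V W (f : V -> W) (v : W -> M) (t : term L V) :
  eval v (rename_term f t) = eval (v \o f) t.
Proof. by elim: t => //= g ts IH; congr (fint _); apply: funext. Qed.

Lemma sat_rename (M : structure L) V (phi : formula L V) W (f : V -> W) (v : W -> M) :
  sat v (rename f phi) = sat (v \o f) phi.
Proof.
elim: phi W f v => {V} /=.
- by move=> V W f v.
- by move=> V t u W f v; rewrite !eval_rename.
- by move=> V r ts W f v; congr (rint _); apply: funext => k; rewrite eval_rename.
- by move=> V phi IH1 psi IH2 W f v; rewrite IH1 IH2.
- move=> V phi IH W f v; apply: eq_forall => c; rewrite IH; congr (sat _ phi).
  by apply: funext => -[].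
Qed.

Lemma eval_support V (t : term L V) : exists s : seq {classic V},
  forall (M : structure L) (v v' : V -> M),
  (forall x : {classic V}, x \in s -> v x = v' x) -> eval v t = eval v' t.
Proof.
elim: t => [x|g ts /choice[s IH]].
  by exists [:: x : {classic V}] => M v v' h; apply: h; rewrite mem_seq1.
exists (flatten [seq s k | k <- enum 'I_(farity g)]) => M v v' h /=.
congr fint; apply: funext => k; apply: IH => x xs; apply: h.
by apply/flatten_mapP; exists k; rewrite ?mem_enum.
Qed.

Lemma mem_pmap_id V (s : seq {classic (option V)}) (x : {classic V}) :
  Some x \in s -> x \in (pmap id s : seq {classic V}).
Proof.
elim: s => [//|y s IH] /predU1P[<-|/IH xs]; first exact: mem_head.
by case: y => [y|] //=; apply/orP; right.
Qed.

(** Finitely many variables occur in [phi], although [V] may be infinite; [{classic V}] supplies the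
    equality used by lists. *)
Lemma sat_support V (phi : formula L V) : exists s : seq {classic V},
  forall (M : structure L) (v v' : V -> M),
  (forall x : {classic V}, x \in s -> v x = v' x) -> sat v phi = sat v' phi.
Proof.
elim: phi => {V}.
- by move=> V; exists [::].
- move=> V t u; have [s hs] := eval_support t; have [s' hs'] := eval_support u.
  exists (s ++ s') => M v v' h /=.
  by rewrite (hs M v v') 1?(hs' M v v') // => x xs; apply: h; rewrite mem_cat xs ?orbT.
- move=> V r ts; have /choice[s hs] := fun k => eval_support (ts k).
  exists (flatten [seq s k | k <- enum 'I_(rarity r)]) => M v v' h /=.
  congr rint; apply: funext => k; apply: hs => x xs; apply: h.
  by apply/flatten_mapP; exists k; rewrite ?mem_enum.
- move=> V phi [s hs] psi [s' hs'].
  exists (s ++ s') => M v v' h /=.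
  by rewrite (hs M v v') 1?(hs' M v v') // => x xs; apply: h; rewrite mem_cat xs ?orbT.
- move=> V phi [s hs].
  exists (pmap id s : seq {classic V}) => M v v' h /=.
  apply: eq_forall => c; apply: hs => -[x|//] xs /=; apply: h.
  exact: mem_pmap_id.
Qed.

(** [SkWit] takes formulas over [option nat], so the free variables of a quantified formula are
    replaced by their positions in a finite support. *)
Lemma rename_bound_to_nat V (phi : formula L (option V)) : exists s : seq {classic V},
  forall (M : structure L) (v : V -> M) (w : nat -> M) c,
  (forall x : {classic V}, x \in s -> w (index x s) = v x) ->
  sat (fun x => oapp w c x) (rename (omap (fun x : {classic V} => index x s)) phi) =
  sat (fun x => oapp v c x) phi.
Proof.
have [s hs] := sat_support phi.
exists (pmap id s : seq {classic V}) => M v w c h.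
rewrite sat_rename; apply: hs => -[x|//] xs /=; apply: h.
exact: mem_pmap_id.
Qed.

End Syntax.

(** * Skolem hulls in ultrapowers *)

Section Skolem.
Context (L : language).

(* Terms naming the elements of a countably generated Skolem hull.  Built from
   [SkCons] and [SkVar], a term also serves as a finite environment, whose n-th
   entry is its n-th component; [SkWit phi e] names a witness of [phi] in the
   environment [e]. *)
Inductive skolem : Type :=
| SkVar of nat
| SkCons of skolem & skolem
| SkWit of formula L (option nat) & skolem.

(* No code is [Falsum], so [SkCons] and [SkWit] terms have different codes. *)
Fixpoint skolem_code (t : skolem) : formula L nat :=
  match t with
  | SkVar n => Eq (Var L n) (Var L n)
  | SkCons a b => Imp (skolem_code a) (skolem_code b)
  | SkWit phi e => Imp Falsum (Imp (All phi) (skolem_code e))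
  end.

Lemma skolem_code_inj : injective skolem_code.
Proof.
elim=> [n|a IHa b IHb|phi e IHe] [n'|a' b'|phi' e'] //=.
- by move=> [->].
- by move=> [/IHa -> /IHb ->].
- by case: a {IHa} => // ? ?.
- by case: a' => // ? ?.
- by move=> [-> /IHe ->].
Qed.

Context (U : structure L).

(** The first component is the element named by the term, the second its environment; where one of
    them has no meaning, [v 0] fills in. *)
Fixpoint sk_eval (v : nat -> U) (t : skolem) : U * (nat -> U) :=
  match t with
  | SkVar n => (v n, fun=> v 0)
  | SkCons a b => (v 0, fun n =>
      if n is n'.+1 then (sk_eval v b).2 n' else (sk_eval v a).1)
  | SkWit phi e =>
     (xget (v 0 : {classic U})
        [set c | sat (fun x => oapp (sk_eval v e).2 c x) phi], fun=> v 0)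
  end.

Definition sk_val v t := (sk_eval v t).1.

Definition sk_list (s : seq skolem) := foldr SkCons (SkVar 0) s.

Lemma sk_listE v s n : (sk_eval v (sk_list s)).2 n = nth (v 0) (map (sk_val v) s) n.
Proof. by elim: s n => [|t s IH] [|n] //=. Qed.

Lemma sk_witP v phi e : (exists c, sat (fun x => oapp (sk_eval v e).2 c x) phi) ->
  sat (fun x => oapp (sk_eval v e).2 (sk_val v (SkWit phi e)) x) phi.
Proof. by move=> h; have := xgetPex (v 0 : {classic U}) h. Qed.

(** The value of a function is the only witness of an equation, so [SkWit] also expresses function
    symbols. *)
Definition sk_app (f : Defs.fsym L) (ts : 'I_(farity f) -> skolem) : skolem :=
  SkWit (Eq (Var L None) (App (fun k : 'I_(farity f) => Var L (Some (val k)))))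
    (sk_list [seq ts k | k <- enum 'I_(farity f)]).

Lemma sk_val_app v f (ts : 'I_(farity f) -> skolem) :
  sk_val v (sk_app ts) = fint (fun k => sk_val v (ts k)).
Proof.
have := @sk_witP v (Eq (Var L None) (App (fun k : 'I_(farity f) => Var L (Some (val k)))))
    (sk_list [seq ts k | k <- enum 'I_(farity f)]).
rewrite -/(sk_app ts) /=; set y := fint _; move=> ->; last by exists y.
rewrite /y; congr fint; apply: funext => k; rewrite sk_listE -map_comp.
by rewrite (nth_map k) ?size_enum_ord // nth_ord_enum.
Qed.

Context (Idx : Type) (F : set_system Idx) (UF : UltraFilter F) (v : Idx -> nat -> U).

Let FF : Filter F := _.

Let F_S (P Q : set Idx) : (forall i, P i -> Q i) -> F P -> F Q.
Proof. exact: filterS. Qed.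

Let F_S2 (P Q R : set Idx) : (forall i, P i -> Q i -> R i) -> F P -> F Q -> F R.
Proof. exact: filterS2. Qed.

Let F_forall (I : finType) (f : I -> set Idx) :
  (forall k, F (f k)) -> F [set i | forall k, f k i].
Proof. exact: filter_forall. Qed.

Let eqF (t u : skolem) := F [set i | sk_val (v i) t = sk_val (v i) u].

(** The choice made by [xget] depends only on the class of [t], so the fixed points of [canon]
    represent the quotient by [eqF]. *)
Let canon (t : skolem) : skolem :=
  xget (SkVar 0 : {classic skolem}) [set u | eqF t u].

Let eqF_refl t : eqF t t. Proof. exact: filterE. Qed.

Let eqF_canon t : eqF t (canon t).
Proof. by have := @xgetI {classic skolem} (SkVar 0) [set u | eqF t u] t (eqF_refl t). Qed.

Let canon_eq t u : eqF t u -> canon t = canon u.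
Proof.
move=> tu; rewrite /canon.
suff -> : [set w | eqF t w] = [set w | eqF u w] by [].
apply/seteqP; split => w /=.
  by apply: F_S2 tu => i /= ->.
by apply: F_S2 tu => i /= ->.
Qed.

Let sk_dom := {t : skolem | canon t = t}.

Let cls (t : skolem) : sk_dom := exist _ (canon t) (esym (canon_eq (eqF_canon t))).

Let cls_rep (x : sk_dom) : cls (sval x) = x.
Proof. by case: x => t e; apply: eq_exist. Qed.

(* The Skolem hull of the classes of the [v ^~ n] in the ultrapower of [U]. *)
Definition sk_structure : structure L :=
  @Structure L sk_dom (inhabits (cls (SkVar 0)))
    (fun f ts => cls (sk_app (fun k => sval (ts k))))
    (fun r ts => F [set i | rint (fun k => sk_val (v i) (sval (ts k)))]).

Let ev (i : Idx) (x : sk_structure) : U := sk_val (v i) (sval x).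

Let ev_cls t : F [set i | ev i (cls t) = sk_val (v i) t].
Proof. by apply: F_S (eqF_canon t) => i. Qed.

Let ev_eval V (x : V -> sk_structure) (t : term L V) :
  F [set i | ev i (eval x t) = eval (ev i \o x) t].
Proof.
elim: t => [z|f ts IH] /=; first exact: filterE.
apply: F_S2 (F_forall IH) (ev_cls (sk_app (fun k => sval (eval x (ts k))))) => i /= e ->.
by rewrite sk_val_app; congr fint; apply: funext => k; rewrite -e.
Qed.

Let F_iff A B : F [set i | A i <-> B i] -> F A <-> F B.
Proof.
by move=> h; split=> hA; apply: F_S2 h hA => i [] /=.
Qed.

(** As in the theorem of Los, but quantifiers range over the hull alone: if [All phi] fails on a set
    in [F], a [SkWit] term for [Not phi] names counterexamples there. *)
Lemma los V (phi : formula L V) (x : V -> sk_structure) :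
  sat x phi <-> F [set i | sat (ev i \o x) phi].
Proof.
elim: phi x => {V}.
- by move=> V x; split=> [[]|/filter_ex[]].
- move=> V t u x.
  have e : eval x t = eval x u <-> F [set i | ev i (eval x t) = ev i (eval x u)].
    split=> [->|h]; first exact: filterE.
    by rewrite -[LHS]cls_rep -[RHS]cls_rep; apply: eq_exist; apply: canon_eq.
  apply: (iff_trans e).
  by apply: F_iff; apply: F_S2 (ev_eval x t) (ev_eval x u) => i /= -> ->.
- move=> V r ts x; apply: (F_iff (A := fun i => rint _)).
  have := F_forall (fun k => ev_eval x (ts k)); apply: F_S => i /= h.
  suff -> : (fun k => sk_val (v i) (sval (eval x (ts k)))) =
            (fun k => eval (ev i \o x) (ts k)) by [].
  by apply: funext => k; rewrite -h.
- move=> V phi IH1 psi IH2 x /=; rewrite IH1 IH2; split=> [h|h1 h2]; last first.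
    by apply: F_S2 h1 h2 => i /=; apply.
  have [/h h1|] := in_ultra_setVsetC [set i | sat (ev i \o x) phi] UF.
    by apply: F_S h1 => i /= ? ?.
  by apply: F_S => i /= ? ?.
- move=> V phi IH x; split=> [h|h c]; last first.
    apply/IH; apply: F_S h => i /= /(_ (ev i c)).
    by congr (sat _ phi); apply: funext => -[].
  have [//|nF] := in_ultra_setVsetC
    [set i | forall c, sat (fun z => oapp (ev i \o x) c z) phi] UF.
  have [s hs] := rename_bound_to_nat (Not phi).
  pose e := sk_list [seq sval (x z) | z <- s].
  pose t := SkWit (rename (omap (fun z : {classic V} => index z s)) (Not phi)) e.
  have he i c : sat (fun z => oapp (sk_eval (v i) e).2 c z)
     (rename (omap (fun z : {classic V} => index z s)) (Not phi)) =
     sat (fun z => oapp (ev i \o x) c z) (Not phi).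
    apply: hs => z zs; rewrite sk_listE -map_comp (nth_map z) ?index_mem //=.
    by rewrite nth_index.
  have ht : F [set i | ~ sat (fun z => oapp (ev i \o x) (sk_val (v i) t) z) phi].
    apply: F_S nF => i /= /existsNP[c nc].
    have := @sk_witP (v i)
      (rename (omap (fun z : {classic V} => index z s)) (Not phi)) e.
    by rewrite he; apply; exists c; rewrite he.
  have /IH hc := h (cls t).
  have bad : F [set i | ~ sat (ev i \o (fun z => oapp x (cls t) z)) phi].
    apply: F_S2 ht (ev_cls t) => i /= nc e'; apply: contra_not nc.
    by rewrite -e'; congr (sat _ phi); apply: funext => -[].
  have /filter_ex[i []//] : F set0 by apply: F_S2 hc bad.
Qed.

Lemma skolem_ultraproduct : exists (M : structure L) (w : nat -> M),
  [set: M] #<= [set: formula L nat] /\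
  (forall phi : formula L void, holds U phi -> holds M phi) /\
  (forall phi : formula L nat, F [set i | sat (v i) phi] -> sat w phi).
Proof.
exists sk_structure, (fun n => cls (SkVar n)); split; [|split].
- apply: (@injective_card_le _ _ (fun x : sk_structure => skolem_code (sval x))).
  by move=> x y /skolem_code_inj xy; rewrite -[x]cls_rep xy cls_rep.
- move=> phi hU; apply/los.
  apply: filterE => i; move: hU; rewrite /holds.
  by congr (sat _ phi); apply: funext => -[].
- move=> phi h; apply/los.
  have [s hs] := sat_support phi.
  (* For each [n], [cls (SkVar n)] agrees with [v i n] on a set in [F] depending on [n]; finite
     support leaves finitely many sets to intersect. *)
  have hw : F [set i | forall k : 'I_(size s),
      ev i (cls (SkVar (nth (0 : {classic nat}) s k))) =
      v i (nth (0 : {classic nat}) s k)].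
    by apply: F_forall => k; apply: ev_cls.
  apply: F_S2 h hw => i /= hi hvw; rewrite -(hs _ (v i)) // => x xs /=.
  have xlt : (index x s < size s)%N by rewrite index_mem.
  by have := hvw (Ordinal xlt); rewrite /= nth_index.
Qed.

End Skolem.

(** The index set consists of finite lists of conditions, each with an assignment satisfying it; the
    ultrafilter contains, for each condition, the set of lists in which it occurs. The hull is no
    larger than [formula L nat], hence small, and embeds into [U]. *)
Lemma monster_compact (L : language) (T : theory L) (K : Type) (U : structure L)
    (C : Type) (Phi : C -> formula L nat) :
  sufficiently_large L K -> monster K U T ->
  (forall r (c : 'I_r -> C), exists v : nat -> U, forall l, sat v (Phi (c l))) ->
  exists v : nat -> U, forall c, sat v (Phi c).
Proof.
move=> [FK KF] [UT U_univ _] fin.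
pose sats (i : seq {classic C}) (v : nat -> U) := forall c, c \in i -> sat v (Phi c).
have /choice[v hv] : forall i : seq {classic C}, exists v : nat -> U, sats i v.
  move=> i; have [v hv] := fin _ (tnth (in_tuple i)); exists v => c.
  by rewrite -[_ \in _]/(c \in in_tuple i) => /tnthP[l ->].
pose F0 : set_system (seq {classic C}) :=
  [set A | exists s : seq {classic C}, forall i, {subset s <= i} -> A i].
have F0_proper : ProperFilter F0.
  split; first by move=> [s hs]; apply: (hs s).
  split.
  - by exists [::].
  - move=> A B [s hs] [s' hs']; exists (s ++ s') => i si; split.
      by apply: hs => x xs; apply: si; rewrite mem_cat xs.
    by apply: hs' => x xs; apply: si; rewrite mem_cat xs orbT.
  - by move=> A B AB [s hs]; exists s => i /hs/AB.
have [F [UF F0F]] := ultraFilterLemma F0_proper.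
have [M [w [cM [MT hw]]]] := skolem_ultraproduct UF v.
have [||h hemb] := U_univ M.
- split; first exact: card_le_trans FK.
  by move=> KM; apply: KF; apply: card_le_trans cM.
- by move=> phi /UT/MT.
exists (h \o w) => c; apply/hemb; apply: hw; apply: F0F.
by exists [:: c : {classic C}] => i ci; apply: hv; apply: ci; rewrite mem_seq1.
Qed.

(** * From IP_m to a failure of m-distality *)

Lemma infinite_enum (T : Type) (A : set T) : infinite_set A ->
  exists f : nat -> T, injective f /\ forall n, A (f n).
Proof.
elim/Ppointed: T => T in A *; first by rewrite emptyE => /(_ (finite_set0 _)).
move=> /infiniteP/pcard_leP[f]; exists f; split=> [x y|n]; last exact: funS.
by apply: (@inj _ _ _ f); rewrite inE.
Qed.

(* The parameters of [phi] become part of the tuple, and finite support makes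
   it a tuple indexed by [nat]; the coordinates of [x_i] are read in the i-th
   tuple, those of [y] and the parameters in the last one. *)
Lemma independent_hypergraph (L : language) (U : structure L) (m : nat)
    (X : 'I_m -> Type) (Y : Type) (phi : formula L ({i : 'I_m & X i} + Y + U)) :
  m_independent_formula phi ->
  exists psi : formula L ('I_m.+1 * nat),
  forall (V : countType) (g : ('I_m.+1 -> V) -> bool),
  exists c : V -> nat -> U, forall u,
    sat (fun z => c (u z.1) z.2) psi <-> g u.
Proof.
move=> [A [A_inf shatter]].
have /all_sig[a ha] i := cid (infinite_enum (A_inf i)).
have [s hs] := sat_support phi.
pose role (z : {i : 'I_m & X i} + Y + U) : 'I_m.+1 :=
  if z is inl (inl (existT i _)) then lift ord_max i else ord_max.
exists (rename (fun z : {classic _} => (role z, index z s)) phi) => V g.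
have /choice[c hc] : forall w : V, exists c : Y -> U,
   forall u : 'I_m -> V, sat (ip_env (fun i => a i (pickle (u i))) c) phi <->
     g (fun k => oapp u w (unlift ord_max k)).
  (* [B] is the link of [w]: the tuples that complete the last vertex [w] to an edge of [g]. *)
  move=> w; pose B := [set b : forall i, X i -> U | exists2 u : 'I_m -> V,
     b = (fun i => a i (pickle (u i))) & g (fun k => oapp u w (unlift ord_max k))].
  have [|c Bc] := shatter B.
    by move=> _ [u -> _] i; case: (ha i).
  exists c => u; apply: (iff_trans (B := B (fun i => a i (pickle (u i))))).
    by rewrite Bc /=; split=> [h|[]//]; split=> // i; case: (ha i).
  split=> [[u' e]|gu]; last by exists u.
  suff -> : u = u' by [].
  apply: funext => i; apply: (pcan_inj pickleK); have [ai _] := ha i; apply: ai.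
  exact: (congr1 (fun b => b i) e).
have [u0] := dom_inhabited U.
(* The tuple of a vertex carries the data of all roles at once, and [psi] selects by [role];
   [inr u0] fills the positions beyond the support. *)
exists (fun v n => ip_env (fun i => a i (pickle v)) (c v)
                     (nth (inr u0 : {classic _}) s n)) => u.
have -> : g u = g (fun k =>
    oapp (fun i => u (lift ord_max i)) (u ord_max) (unlift ord_max k)).
  by congr g; apply: funext => k; case: unliftP => [j|] ->.
rewrite -hc sat_rename.
rewrite (hs _ _ (ip_env (fun i => a i (pickle (u (lift ord_max i))))
                   (c (u ord_max)))) //.
move=> z zs /=; rewrite nth_index //.
by case: z zs => [[[i x]|y]|p].
Qed.

(** * Sequences that become indiscernible when any one marked point is removed *)

Section AlmostIndiscernible.
Context (L : language) (m : nat) (d : Order.disp_t) (O : orderType d).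
Context (pts anch : 'I_m.+1 -> O).

(* One instance of indiscernibility of the sequence without [pts avoided]. *)
Record avoiding_instance := AvoidingInstance {
  arity : nat;
  fml : formula L ('I_arity * nat);
  avoided : 'I_m.+1;
  tup : 'I_arity -> O;
  tup' : 'I_arity -> O;
  tup_homo : {homo tup : i j / (i < j)%O};
  tup'_homo : {homo tup' : i j / (i < j)%O};
  tup_avoids : forall k, tup k != pts avoided;
  tup'_avoids : forall k, tup' k != pts avoided }.

Arguments tup : clear implicits.
Arguments tup' : clear implicits.

Definition support (x : avoiding_instance) : seq O :=
  codom (tup x) ++ codom (tup' x).

(** Only a finite set [F] of points is involved; ranks in [F] reduce the claim to
    [transversal_ramsey], with truth values of the formulas as colours. *)
Lemma finite_almost_indiscernible (U : structure L)
    (psi : formula L ('I_m.+1 * nat)) r (x : 'I_r -> avoiding_instance) :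
  (forall (V : countType) (g : ('I_m.+1 -> V) -> bool),
    exists c : V -> nat -> U, forall u,
      sat (fun z => c (u z.1) z.2) psi <-> g u) ->
  {homo pts : i j / (i < j)%O} -> (forall i j, anch i != pts j) ->
  exists c : O -> nat -> U,
    ~ (sat (fun z => c (pts z.1) z.2) psi <-> sat (fun z => c (anch z.1) z.2) psi)
    /\ forall l, sat (fun z => c (tup (x l) z.1) z.2) (fml (x l)) ->
                 sat (fun z => c (tup' (x l) z.1) z.2) (fml (x l)).
Proof.
move=> psi_gen pts_homo anch_pts.
pose F := sort <=%O (undup (codom pts ++ codom anch ++
                            flatten [seq support (x l) | l <- enum 'I_r])).
have F_sorted : sorted <%O F by rewrite sort_lt_sorted undup_uniq.
have mem_F o : (o \in F) = (o \in codom pts) || (o \in codom anch) ||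
    (o \in flatten [seq support (x l) | l <- enum 'I_r]).
  by rewrite mem_sort mem_undup !mem_cat orbA.
have ptsF j : pts j \in F by rewrite mem_F codom_f.
have anchF j : anch j \in F by rewrite mem_F codom_f orbT.
have tupF l k : tup (x l) k \in F.
  rewrite mem_F; apply/orP; right; apply/flatten_mapP; exists l; rewrite ?mem_enum //.
  by rewrite mem_cat codom_f.
have tup'F l k : tup' (x l) k \in F.
  rewrite mem_F; apply/orP; right; apply/flatten_mapP; exists l; rewrite ?mem_enum //.
  by rewrite mem_cat codom_f orbT.
have q_gt0 : (index (pts ord0) F < size F)%N by rewrite index_mem.
pose rk o : 'I_(size F) := insubd (Ordinal q_gt0) (index o F).
have rkE o : o \in F -> rk o = index o F :> nat.
  by move=> oF; rewrite val_insubd index_mem oF.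
have rk_inj o o' : o \in F -> o' \in F -> rk o = rk o' -> o = o'.
  move=> oF o'F e; rewrite -(nth_index o oF) -(nth_index o o'F).
  by rewrite -(rkE _ oF) -(rkE _ o'F) e.
have rk_homo o o' : o \in F -> o' \in F -> (o < o')%O -> (rk o < rk o')%O.
  move=> oF o'F oo'; rewrite ltEord /= !rkE //.
  rewrite -(lt_sorted_ltn_nth o F_sorted) ?inE ?index_mem //.
  by rewrite !nth_index.
have pts_inj : injective pts.
  by move=> i j e; case: (ltgtP i j) => // /pts_homo; rewrite e ltxx.
have rkpts_inj : injective (rk \o pts).
  by move=> i j /rk_inj; rewrite !ptsF => /(_ isT isT)/pts_inj.
have [M [N [g Hg]]] := transversal_ramsey (fun l => arity (x l)) rkpts_inj.
(* [g] is fixed before the colouring, so the tuples [C] that realize it may be used to define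
   [chi]. *)
pose vertex : countType := ('I_M.+1 * 'I_N.+1)%type.
have [C hC] := psi_gen vertex (fun u => g [ffun k => (u k).2]).
pose chi l (u : 'I_(arity (x l)) -> vertex) : bool :=
  `[< sat (fun z => C (u z.1) z.2) (fml (x l)) >].
have [W [s [W_homo hv]]] := Hg chi.
(* The labels at [anch] come from [s], whatever value is requested at [pts]; so the opposite value
   is requested. *)
have [f [s' [gf s'pts s'rest mono]]] := hv (~~ g [ffun k => s (W (rk (anch k)))]).
exists (fun o => C (W (rk o), s' (W (rk o)))); split.
  move=> h; have h1 := hC (fun k => (W (rk (pts k)), s' (W (rk (pts k))))).
  have h2 := hC (fun k => (W (rk (anch k)), s' (W (rk (anch k))))).
  have := iff_trans (iff_sym h1) (iff_trans h h2).
  rewrite /=.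
  have -> : [ffun k => s' (W (rk (pts k)))] = f.
    by apply/ffunP => k; rewrite ffunE s'pts.
  have -> : [ffun k => s' (W (rk (anch k)))] = [ffun k => s (W (rk (anch k)))].
    apply/ffunP => k; rewrite !ffunE s'rest // => j.
    by apply: contraNneq (anch_pts k j) => /rk_inj ->.
  by rewrite gf; case: (g _) => -[h3 h4]; [have := h4 isT | have := h3 isT].
move=> l.
have := mono (avoided (x l)) l (rk \o tup (x l)) (rk \o tup' (x l)).
rewrite /chi => h /asboolP ht; apply/asboolP; rewrite -h //=.
- by move=> i j ij; apply: rk_homo => //; apply: tup_homo.
- by move=> i j ij; apply: rk_homo => //; apply: tup'_homo.
- by move=> k; apply: contraNneq (tup_avoids k) => /rk_inj ->.
- by move=> k; apply: contraNneq (tup'_avoids k) => /rk_inj ->.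
Qed.

End AlmostIndiscernible.

Arguments tup {L m d O pts}.
Arguments tup' {L m d O pts}.

(** Compactness with one variable for each coordinate of each tuple, coded in [nat] through [code].
    Two implications in [Phi] say that [psi] separates [pts] from [anch]. *)
Lemma almost_indiscernible (L : language) (T : theory L) (K : Type)
    (U : structure L) (m : nat) (d : Order.disp_t) (O : orderType d)
    (pts anch : 'I_m.+1 -> O) (code : O -> nat) (psi : formula L ('I_m.+1 * nat)) :
  sufficiently_large L K -> monster K U T -> injective code ->
  (forall (V : countType) (g : ('I_m.+1 -> V) -> bool),
    exists c : V -> nat -> U, forall u,
      sat (fun z => c (u z.1) z.2) psi <-> g u) ->
  {homo pts : i j / (i < j)%O} -> (forall i j, anch i != pts j) ->
  exists c : O -> nat -> U,
    ~ (sat (fun z => c (pts z.1) z.2) psi <-> sat (fun z => c (anch z.1) z.2) psi)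
    /\ forall x : avoiding_instance L pts,
         sat (fun z => c (tup x z.1) z.2) (fml x) ->
         sat (fun z => c (tup' x z.1) z.2) (fml x).
Proof.
move=> K_large U_monster code_inj psi_gen pts_homo anch_pts.
pose cd (z : O * nat) : nat := pickle (code z.1, z.2).
have cd_inj : injective cd.
  by move=> [o n] [o' n'] /(pcan_inj pickleK)[/code_inj -> ->].
pose inst n (t : 'I_n -> O) (phi : formula L ('I_n * nat)) :=
  rename (fun z => cd (t z.1, z.2)) phi.
pose Phi (x : bool + avoiding_instance L pts) : formula L nat :=
  match x with
  | inl true => Imp (inst _ pts psi) (Not (inst _ anch psi))
  | inl false => Imp (Not (inst _ pts psi)) (inst _ anch psi)
  | inr x => Imp (inst _ (tup x) (fml x)) (inst _ (tup' x) (fml x))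
  end.
have sat_inst (v : nat -> U) (c : O -> nat -> U) n (t : 'I_n -> O) phi :
    (forall o k, v (cd (o, k)) = c o k) ->
    sat v (inst n t phi) = sat (fun z => c (t z.1) z.2) phi.
  by move=> vc; rewrite /inst sat_rename; congr (sat _ phi); apply: funext => z /=.
have [r x|v hv] := monster_compact (Phi := Phi) K_large U_monster.
  have z0 : 'I_0 -> O by case.
  (* The finite lemma takes only instances; conditions on [psi], which it always ensures, are
     replaced by a trivial instance. *)
  have dummy : avoiding_instance L pts.
    by apply: (@AvoidingInstance L m d O pts 0 Falsum ord0 z0 z0) => -[].
  pose x' l := if x l is inr y then y else dummy.
  have [c [c_psi c_x]] := finite_almost_indiscernible x' psi_gen pts_homo anch_pts.
  have /choice[v hv] : forall n, exists u : U, forall o k, cd (o, k) = n -> u = c o k.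
    move=> n; have [[[o k] e]|no] := pselect (exists z, cd z = n).
      by exists (c o k) => o' k'; rewrite -e => /cd_inj[-> ->].
    by exists (c (pts ord0) 0) => o k e; case: no; exists (o, k).
  have vc o k : v (cd (o, k)) = c o k by apply: hv.
  exists v => l; have := c_x l; rewrite /x'; case: (x l) => [[]|y] /=.
  - by rewrite !(sat_inst _ c) // => _ h1 h2; apply: c_psi.
  - rewrite !(sat_inst _ c) // => _ h1; apply: contrapT => h2; apply: c_psi.
    by split.
  - by rewrite !(sat_inst _ c).
exists (fun o n => v (cd (o, n))); split.
  move=> h; have h1 := hv (inl true); have h2 := hv (inl false).
  move: h1 h2; rewrite /= !(sat_inst _ (fun o n => v (cd (o, n)))) // => h1 h2.
  have ns : ~ sat (fun z => v (cd (pts z.1, z.2))) psi.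
    by move=> hp; apply: (h1 hp); apply/h.
  by apply: (ns); apply/h; apply: h2.
move=> x; have := hv (inr x).
by rewrite /= !(sat_inst _ (fun o n => v (cd (o, n)))).
Qed.

(** * The failure of m-distality *)

Lemma indiscernible_intro (L : language) (U : structure L) (I X : Type)
    (lt : rel I) (b : I -> X -> U) :
  (forall n (theta : formula L ('I_n * X)) (t t' : 'I_n -> I),
    (forall k l : 'I_n, (k < l)%N -> lt (t k) (t l)) ->
    (forall k l : 'I_n, (k < l)%N -> lt (t' k) (t' l)) ->
    sat (fun z => b (t z.1) z.2) theta -> sat (fun z => b (t' z.1) z.2) theta) ->
  indiscernible lt b.
Proof.
(* Either some increasing tuple satisfies [theta], and then all do, or all satisfy its negation. *)
move=> h n theta; have [[t [ht st]]|no] := pselect (exists t : 'I_n -> I,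
    (forall k l : 'I_n, (k < l)%N -> lt (t k) (t l)) /\
    sat (fun z => b (t z.1) z.2) theta).
  by left=> t' ht'; apply: h st.
by right=> t ht; apply: contra_not no => st; exists t.
Qed.

Lemma small_countable (L : language) (K X : Type) (code : X -> nat) :
  sufficiently_large L K -> injective code -> small K X.
Proof.
move=> [FK KF] code_inj.
have XF : [set: X] #<= [set: formula L nat].
  apply: (@injective_card_le _ _ (fun x => Eq (Var L (code x)) (Var L (code x)))).
  by move=> x y [/code_inj].
split; first exact: card_le_trans FK.
by move=> KX; apply: KF; apply: card_le_trans XF.
Qed.

Lemma ltxi_fst d d' (A : orderType d) (B : orderType d') (x y : A *l B) :
  (x.1 < y.1)%O -> (x < y)%O.
Proof.
by case: x y => [x s] [y t] /= xy; rewrite ltxi_pair ltW //= leNgt xy.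
Qed.

(** Each block is a copy of the integers, so no endpoint is adjacent to a cut. *)
Lemma lexi_dedekind m : @dedekind_partition _ ('I_m.+2 *l int) m.+1 (fun x => x.1).
Proof.
split=> [k|[i a] [j b]|k].
- by exists (k, 0%Z).
- by rewrite lexi_pair => /andP[].
- split=> -[[i z] /= ik h].
    by have := h (i, z + 1)%R ik; rewrite lexi_pair lexx /= gerDl.
  by have := h (i, z - 1)%R ik; rewrite lexi_pair lexx /= -subr_ge0 addrAC subrr add0r.
Qed.

Theorem proposition6p7 (L : language) (T : theory L)
    (T_complete : complete_theory T) (T_infinite : has_infinite_models T)
    (K : Type) (K_large : sufficiently_large L K)
    (U : structure L) (U_monster : monster K U T)
    (m : nat) (m_gt0 : (0 < m)%N) :
  m_distal K U m -> m_dependent K U m.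
Proof.
move=> distal X Y phi _ _ /independent_hypergraph[psi psi_gen].
(* The points [pts j] are the ones inserted at the cuts of the sequence indexed
   by [I], which sits in the even blocks of [O]. *)
pose O := nat *l int; pose I := 'I_m.+2 *l int.
pose pts (j : 'I_m.+1) : O := (j.*2.+1, 0%Z).
(* [anch] lies in block 0, inside the sequence; [psi] is made to take different truth values at
   [anch] and at [pts]. *)
pose anch (j : 'I_m.+1) : O := (0%N, Posz j).
have pts_homo : {homo pts : i j / (i < j)%O}.
  move=> i j ij; apply: ltxi_fst.
  by rewrite -[X in is_true X]/(i.*2.+1 < j.*2.+1)%N ltnS ltn_double.
have anch_homo : {homo anch : i j / (i < j)%O}.
  by move=> i j ij; rewrite ltxi_pair lexx /= ltz_nat.
have anch_pts i j : anch i != pts j by [].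
have [c [c_psi c_ind]] := almost_indiscernible K_large U_monster
  (code := pickle : O -> nat) (pcan_inj pickleK) psi_gen pts_homo anch_pts.
have {}c_ind j n (theta : formula L ('I_n * nat)) (t t' : 'I_n -> O) :
    {homo t : k l / (k < l)%O} -> {homo t' : k l / (k < l)%O} ->
    (forall k, t k != pts j) -> (forall k, t' k != pts j) ->
    sat (fun z => c (t z.1) z.2) theta -> sat (fun z => c (t' z.1) z.2) theta.
  by move=> h1 h2 h3 h4; apply: (c_ind (AvoidingInstance theta h1 h2 h3 h4)).
pose emb (i : I) : O := (i.1.*2, i.2).
pose b (i : I) := c (emb i).
pose a (j : 'I_m.+1) := c (pts j).
pose p (i : I) : 'I_m.+2 := i.1.
have emb_homo (i i' : I) : (i < i')%O -> (emb i < emb i')%O.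
  case: i i' => [i z] [i' z']; rewrite !ltxi_pair /= => /andP[ii' h].
  by rewrite !leEnat !leq_double; apply/andP.
have emb_pts i j : emb i != pts j.
  apply/eqP => -[/(congr1 odd)]; by rewrite /= !odd_double.
have b_ind : indiscernible <%O b.
  apply: indiscernible_intro => n theta t t' ht ht'.
  apply: (c_ind ord0 n theta (emb \o t) (emb \o t')) => [k l kl|k l kl|k|k].
  - exact/emb_homo/ht.
  - exact/emb_homo/ht'.
  - exact: emb_pts.
  - exact: emb_pts.
have I_small : small K I.
  exact: (small_countable (code := pickle : I -> nat) K_large (pcan_inj pickleK)).
have I_inf : infinite_set [set: I].
  apply/infiniteP; apply: (@injective_card_le _ _ (fun n => (ord0, Posz n) : I)).
  by move=> x y [].
have nat_small : small K nat by apply: (small_countable (code := id) K_large).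
have G_complete : complete_em_type K U (em_type <%O b).
  by exists _, I, b.
have p_ded : dedekind_partition p := @lexi_dedekind m.
have := distal _ _ nat_small G_complete _ _ b p I_small I_inf b_ind erefl p_ded a.
pose embJ (J : {set 'I_m.+1}) (u : I + {k | k \in J}) : O :=
  match u with inl i => emb i | inr k => pts (val k) end.
have embJ_homo J u w : insertion_lt p (J := J) u w -> (embJ J u < embJ J w)%O.
  case: u w => [i|k] [i'|k'] /= h.
  - exact: emb_homo.
  - apply: ltxi_fst.
    by rewrite -[X in is_true X]/(i.1.*2 < (val k').*2.+1)%N ltnS leq_double.
  - apply: ltxi_fst.
    by rewrite -[X in is_true X]/((val k).*2.+1 < i'.1.*2)%N ltn_Sdouble.
  - exact: pts_homo.
have seqE (J : {set 'I_m.+1}) (u : I + {k | k \in J}) :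
    insertion_seq b a u = c (embJ J u).
  by case: u.
case.
  (* If all of [a] inserted, [psi] would have the same truth value at [pts] and at [anch]. *)
  move=> /(_ _ psi) full; apply: c_psi.
  pose t (k : 'I_m.+1) : I + {k : 'I_m.+1 | k \in [set: 'I_m.+1]%SET} :=
    inr (exist _ k (finset.in_setT k)).
  pose t' (k : 'I_m.+1) : I + {k : 'I_m.+1 | k \in [set: 'I_m.+1]%SET} :=
    inl (ord0, Posz k).
  have ht (k l : 'I_m.+1) : (k < l)%N -> insertion_lt p (t k) (t l) by [].
  have ht' (k l : 'I_m.+1) : (k < l)%N -> insertion_lt p (t' k) (t' l).
    exact: anch_homo.
  case: full => full.
    by split=> _; [apply: (full t' ht') | apply: (full t ht)].
  by split=> h; [case: (full t ht h) | case: (full t' ht' h)].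
move=> J cJ; apply.
(* [J] has only [m] elements and misses some [j]; without [pts j] the sequence is indiscernible, so
   [J] inserts. *)
have [j jJ] : exists j, j \notin J.
  apply/existsP; apply: contraPT cJ; rewrite negb_exists => /forallP J_full.
  suff -> : J = [set: 'I_m.+1]%SET.
    by rewrite cardsT card_ord => /eqP; rewrite eqn_leq ltnn.
  by apply/setP => j; rewrite finset.in_setT; apply/negPn/J_full.
apply: indiscernible_intro => n theta t t' ht ht'.
have E (t0 : 'I_n -> I + {k | k \in J}) :
   (fun z : 'I_n * nat => insertion_seq b a (t0 z.1) z.2) =
   (fun z => c (embJ J (t0 z.1)) z.2).
  by apply: funext => z; rewrite seqE.
have avoid u : embJ J u != pts j.
  case: u => [i|[k kJ]] /=; first exact: emb_pts.
  by apply: contraNneq jJ => -[/double_inj/val_inj <-].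
rewrite !E.
apply: (c_ind j n theta (embJ J \o t) (embJ J \o t')) => [k l kl|k l kl|k|k].
- exact/embJ_homo/ht.
- exact/embJ_homo/ht'.
- exact: avoid.
- exact: avoid.
Qed.
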